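(* Let $n,p$ be positive integers and let $f:\mathbb{R}^n\to\mathbb{R}^p$ be an arbitrary bounded-input bounded-output function. Then there exist an integer $m\ge p+n$, a real unitary (i.e. orthogonal) matrix $U\in\mathbb{R}^{p\times p}$, a real, non-negative, rectangular-diagonal matrix $\Sigma\in\mathbb{R}^{p\times m}$ with diagonal entries $\sigma_1\ge\sigma_2\ge\dots\ge\sigma_p\ge 0$, and a norm-preserving, injective mapping $v:\mathbb{R}^n\to\mathbb{R}^m$ such that $$f(x)=U\,\Sigma\,v(x)\qquad\text{for all }x\in\mathbb{R}^n.$$
   Context: A function $f:\mathbb{R}^n\to\mathbb{R}^p$ (not assumed linear or continuous) is called bounded-input bounded-output if there is a finite constant $c>0$ such that $\|f(x)\|_2\le c\|x\|_2$ for all $x\in\mathbb{R}^n$. A mapping $v:\mathbb{R}^n\to\mathbb{R}^m$ (not assumed linear or continuous) is norm-preserving if $\|v(x)\|_2=\|x\|_2$ for all $x\in\mathbb{R}^n$, where $\|\cdot\|_2$ is the Euclidean norm. A matrix $\Sigma\in\mathbb{R}^{p\times m}$ is rectangular-diagonal if $\Sigma_{ij}=0$ whenever $i\ne j$; its $i$-th diagonal entry is denoted $\sigma_i$. *)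

(* Defs.v *)
From HB Require Import structures.
From mathcomp Require Import all_boot all_order all_algebra.
From mathcomp Require Import reals.

Set Implicit Arguments.
Unset Strict Implicit.
Unset Printing Implicit Defensive.

Import Order.TTheory GRing.Theory Num.Theory.

Local Open Scope ring_scope.

(* Vectors of R^n are column matrices.  MathComp-Analysis equips matrices with
   the sup norm, so the Euclidean norm is defined here. *)
Definition norm2 (R : realType) (n : nat) (x : 'cV[R]_n) : R :=
  Num.sqrt (\sum_(i < n) x i 0 ^+ 2).

Definition bibo (R : realType) (n p : nat) (f : 'cV[R]_n -> 'cV[R]_p) : Prop :=
  exists c : R, 0 < c /\ forall x : 'cV[R]_n, norm2 (f x) <= c * norm2 x.

Definition norm_preserving (R : realType) (n m : nat)
    (v : 'cV[R]_n -> 'cV[R]_m) : Prop :=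
  forall x : 'cV[R]_n, norm2 (v x) = norm2 x.

(* MathComp's unitarymx requires a numClosedFieldType, hence does not apply to
   real matrices. *)
Definition orthogonal_mx (R : realType) (p : nat) (U : 'M[R]_p) : Prop :=
  U^T *m U = 1%:M /\ U *m U^T = 1%:M.

Definition nonneg_mx (R : realType) (p m : nat) (S : 'M[R]_(p, m)) : Prop :=
  forall (i : 'I_p) (j : 'I_m), 0 <= S i j.

(* A wide matrix (p <= m) has exactly p diagonal entries; they are indexed
   from 0. *)
Definition diag_entry (R : realType) (p m : nat) (le_pm : (p <= m)%N)
    (S : 'M[R]_(p, m)) (i : 'I_p) : R :=
  S i (widen_ord le_pm i).

(* Main.v *)
(* Take U = I, m = p + n and S = [s I | 0] with s > c, c a bound for f, and set
   v x = (f x / s ; a x) with a = sqrt (1 - |f x|^2 / (s |x|)^2).  The factor a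
   makes v norm-preserving, and a > 0 because s > c.  If v x = v y then
   f x = f y and |x| = |y|, so the factors of x and y agree and x = y. *)

Require Import Defs.
From HB Require Import structures.
From mathcomp Require Import all_boot all_order all_algebra.
From mathcomp Require Import reals.
From mathcomp Require Import ring.

Set Implicit Arguments.
Unset Strict Implicit.
Unset Printing Implicit Defensive.

Import Order.TTheory GRing.Theory Num.Theory.

Local Open Scope ring_scope.

Lemma norm2_ge0 (R : realType) (n : nat) (x : 'cV[R]_n) : 0 <= norm2 x.
Proof. exact: sqrtr_ge0. Qed.

Lemma norm2_sqr (R : realType) (n : nat) (x : 'cV[R]_n) :
  norm2 x ^+ 2 = \sum_(i < n) x i 0 ^+ 2.
Proof. by rewrite sqr_sqrtr // sumr_ge0 // => i _; rewrite sqr_ge0. Qed.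

Lemma norm2_col_mx_sqr (R : realType) (p n : nat) (x : 'cV[R]_p)
    (y : 'cV[R]_n) :
  norm2 (col_mx x y) ^+ 2 = norm2 x ^+ 2 + norm2 y ^+ 2.
Proof.
rewrite !norm2_sqr big_split_ord /=.
by congr (_ + _); apply: eq_bigr => i _; rewrite (col_mxEu, col_mxEd).
Qed.

Lemma norm2Z_sqr (R : realType) (n : nat) (a : R) (x : 'cV[R]_n) :
  norm2 (a *: x) ^+ 2 = a ^+ 2 * norm2 x ^+ 2.
Proof.
rewrite !norm2_sqr mulr_sumr.
by apply: eq_bigr => i _; rewrite mxE exprMn.
Qed.

Section Lift.

Variables (R : realType) (n p : nat) (f : 'cV[R]_n -> 'cV[R]_p) (c s : R).
Hypotheses (c_gt0 : 0 < c) (c_lt_s : c < s).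
Hypothesis f_bound : forall x, norm2 (f x) <= c * norm2 x.

(* Since x / 0 = 0, the factor is 1 at x = 0. *)
Definition lift_factor (x : 'cV[R]_n) : R :=
  Num.sqrt (1 - (norm2 (f x) / (s * norm2 x)) ^+ 2).

Definition lift (x : 'cV[R]_n) : 'cV[R]_(p + n) :=
  col_mx (s^-1 *: f x) (lift_factor x *: x).

Let s_gt0 : 0 < s. Proof. exact: lt_trans c_lt_s. Qed.

(** If [norm2 x] is positive, then [norm2 (f x) <= c * norm2 x < s * norm2 x], so the quotient is
    below 1; otherwise it is 0 by convention. Strictness makes the factor nonzero, hence cancellable
    in [lift_inj]. *)
Lemma lift_radicand_gt0 (x : 'cV[R]_n) :
  0 < 1 - (norm2 (f x) / (s * norm2 x)) ^+ 2.
Proof.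
rewrite subr_gt0; have := norm2_ge0 x; rewrite le_eqVlt => /predU1P[<-|x_gt0].
  by rewrite mulr0 invr0 mulr0 expr0n ltr01.
have sx_gt0 : 0 < s * norm2 x by rewrite mulr_gt0.
rewrite expr_lt1 ?divr_ge0 ?norm2_ge0 ?(ltW sx_gt0) //.
rewrite ltr_pdivrMr // mul1r (le_lt_trans (f_bound x)) //.
by rewrite ltr_pM2r.
Qed.

Lemma lift_norm_preserving : norm_preserving lift.
Proof.
(* Both norms are nonnegative, so it suffices to compare their squares, which add over the two
   blocks. *)
move=> x; apply/eqP; rewrite -(@eqrXn2 _ 2) ?norm2_ge0 //; apply/eqP.
rewrite norm2_col_mx_sqr !norm2Z_sqr (sqr_sqrtr (ltW (lift_radicand_gt0 x))).
have s_neq0 : s != 0 by rewrite gt_eqF.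
have [x0|x_neq0] := eqVneq (norm2 x) 0.
  (* Here [norm2 x] cannot be cancelled; instead the bound forces [f] to vanish. *)
  have fx0 : norm2 (f x) = 0.
    by apply/eqP; rewrite eq_le norm2_ge0 andbT -(mulr0 c) -x0.
  by rewrite fx0 x0 expr0n !mulr0 addr0.
by field; rewrite x_neq0.
Qed.

Lemma lift_inj : injective lift.
Proof.
move=> x y vxy; have /eq_col_mx[/scalerI fxy axy] := vxy.
have {}fxy : f x = f y by apply: fxy; rewrite invr_eq0 gt_eqF.
(* The factor depends on a vector only through its norm and that of its image, so equal norms make
   the two factors equal. *)
have nxy : norm2 x = norm2 y by rewrite -!lift_norm_preserving vxy.
move: axy; rewrite /lift_factor fxy nxy; apply: scalerI.
by rewrite gt_eqF // sqrtr_gt0 lift_radicand_gt0.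
Qed.

Lemma mul_diag_lift (x : 'cV[R]_n) : row_mx s%:M 0 *m lift x = f x.
Proof.
rewrite mul_row_col mul0mx addr0 mul_scalar_mx scalerA divff ?scale1r //.
by rewrite gt_eqF.
Qed.

End Lift.

Theorem theorem1 (R : realType) (n p : nat) (hn : (0 < n)%N) (hp : (0 < p)%N)
    (f : 'cV[R]_n -> 'cV[R]_p) (hf : bibo f) :
  exists (m : nat) (le_pn_m : (p + n <= m)%N)
         (U : 'M[R]_p) (S : 'M[R]_(p, m)) (v : 'cV[R]_n -> 'cV[R]_m),
    let sigma := diag_entry (leq_trans (leq_addr n p) le_pn_m) S in
    orthogonal_mx U /\
    nonneg_mx S /\
    is_diag_mx S /\
    (forall i j : 'I_p, (i <= j)%N -> sigma j <= sigma i) /\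
    (forall i : 'I_p, 0 <= sigma i) /\
    norm_preserving v /\
    injective v /\
    (forall x : 'cV[R]_n, f x = U *m S *m v x).
Proof.
have [c [c_gt0 f_bound]] := hf.
(* The scale [s] is taken to be [c + 1]; any value above [c] would do. *)
have c_lt_s : c < c + 1 by rewrite ltrDl ltr01.
have s_ge0 : 0 <= c + 1 by rewrite addr_ge0 ?ltW.
exists (p + n)%N, (leqnn _), 1%:M, (row_mx (c + 1)%:M 0), (lift f (c + 1)).
move=> sigma.
have S_ge0 : nonneg_mx (row_mx (c + 1)%:M 0 : 'M[R]_(p, p + n)).
  by move=> i j; rewrite mxE; case: split => k; rewrite mxE ?mulrn_wge0.
have sigmaE i : sigma i = c + 1.
  rewrite /sigma /diag_entry.
  (* The widened index has the same value as the left-block index, so the diagonal entry lies in the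
     scalar block. *)
  set j := widen_ord _ _; have -> : j = lshift n i by apply: val_inj.
  by rewrite row_mxEl mxE eqxx.
split; first by split; rewrite trmx1 mul1mx.
split; first exact: S_ge0.
split.
  (* The right block is zero; in the left one [j] and [k] have the same value, so the entry is off
     the diagonal of a scalar matrix. *)
  apply/is_diag_mxP => i j; rewrite mxE; case: splitP => k jk; rewrite mxE //.
  by rewrite jk -val_eqE => /negPf ->.
split; first by move=> i j _; rewrite !sigmaE.
split; first by move=> i; rewrite sigmaE.
split; first exact: lift_norm_preserving c_gt0 c_lt_s f_bound.
split; first exact: lift_inj c_gt0 c_lt_s f_bound.
by move=> x; rewrite mul1mx (mul_diag_lift _ c_gt0 c_lt_s).
Qed.
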